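(* Let $\beta>0$. Let $\Pi$ be the space of policies $\pi$ such that $\pi(\cdot|x)$ has the same support as $\pi_{\mathrm{ref}}(\cdot|x)$ for every $x\in\mathrm{support}(\rho)$, and assume $\mu\in\Pi$. Let $\pi^*=\arg\max_\pi\mathcal{G}(\pi)$ be the optimal policy. Then $\pi^*$ is the unique global minimum in $\Pi$, on $\mathrm{support}(\rho)$, of both the on-policy loss $$\mathcal{L}(\pi)=\tfrac12\,\mathbb{E}_{x\sim\rho}\Big[\mathbb{V}_{y\sim\pi(\cdot|x)}\big(R^\pi_\beta(x,y)\big)\Big]$$ and the off-policy loss $$\mathcal{L}_\mu(\pi)=\tfrac12\,\mathbb{E}_{x\sim\rho}\Big[\mathbb{V}_{y\sim\mu(\cdot|x)}\big(R^\pi_\beta(x,y)\big)\Big].$$ That is, $\pi^*\in\Pi$ minimizes each loss over $\Pi$, and any $\pi\in\Pi$ minimizing either loss over $\Pi$ satisfies $\pi(\cdot|x)=\pi^*(\cdot|x)$ for all $x\in\mathrm{support}(\rho)$.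
   Context: $\mathcal{X}$ (prompts) and $\mathcal{Y}$ (responses) are countable discrete sets. $\rho$ is a probability distribution on $\mathcal{X}$, with $\mathrm{support}(\rho)=\{x:\rho(x)>0\}$. $r:\mathcal{X}\times\mathcal{Y}\to\mathbb{R}$ is a reward function. A policy $\pi$ assigns to each $x\in\mathcal{X}$ a probability distribution $\pi(\cdot|x)$ on $\mathcal{Y}$; $\pi_{\mathrm{ref}}$ is a fixed reference policy and $\mu$ a fixed behavior policy (not depending on $\pi$). The support of $\pi(\cdot|x)$ is $\{y:\pi(y|x)>0\}$. The KL-regularized objective is $\mathcal{G}(\pi)=\mathbb{E}_{x\sim\rho}\big[\mathbb{E}_{y\sim\pi(\cdot|x)}[r(x,y)]-\beta\,\mathbb{KL}(\pi(\cdot|x),\pi_{\mathrm{ref}}(\cdot|x))\big]$ with $\mathbb{KL}(p,q)=\mathbb{E}_{y\sim p}[\log\frac{p(y)}{q(y)}]$ (equal to $+\infty$ if $p$ is not absolutely continuous with respect to $q$). The maximum is over policies for which $\mathcal{G}$ is well defined in $[-\infty,\infty)$, and the optimal value $\mathcal{G}(\pi^* )$ is assumed to be attained and finite. It is a known fact that for $x\in\mathrm{support}(\rho)$ the maximizer is $$\pi^*(y|x)=\frac{\pi_{\mathrm{ref}}(y|x)\,e^{r(x,y)/\beta}}{\sum_{y'\in\mathcal{Y}}\pi_{\mathrm{ref}}(y'|x)\,e^{r(x,y')/\beta}} .$$ The regularized reward is $R^\pi_\beta(x,y)=r(x,y)-\beta\log\frac{\pi(y|x)}{\pi_{\mathrm{ref}}(y|x)}$,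 defined where both probabilities are positive. $\mathbb{V}_{y\sim\nu}(f(y))=\mathbb{E}_{y\sim\nu}[(f(y)-\mathbb{E}_{y'\sim\nu}f(y'))^2]$ denotes the variance, set to $+\infty$ if $f(y)$ is not square-integrable under $\nu$. *)

(* Defs.v *)
From HB Require Import structures.
From mathcomp Require Import all_boot all_order all_algebra.
From mathcomp Require Import all_classical all_reals all_analysis.

Set Implicit Arguments.
Unset Strict Implicit.
Unset Printing Implicit Defensive.

Import Order.TTheory GRing.Theory Num.Theory.
Import numFieldNormedType.Exports.

Local Open Scope classical_set_scope.
Local Open Scope ring_scope.

Definition countable_discrete d (T : measurableType d) : Prop :=
  countable [set: T] /\ forall A : set T, measurable A.

Section distributions.
Context d (T : measurableType d) (R : realType).
Implicit Types (p q : probability T R) (t : T).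

Definition prob_at p t : R := fine (p [set t]).

Definition prob_support p : set T := [set t | 0 < prob_at p t].

(* [p `<< q] is absolute continuity.  In that branch the junk values of [ln]
   and of division by 0 only occur on a p-null set. *)
Definition KL p q : \bar R :=
  if `[< p `<< q >]
  then ('E_p[fun t => ln (prob_at p t / prob_at q t)])%E
  else +oo%E.

(* The library's integral of f is the integral of f^\+ minus that of f^\-; [+?]
   rules out the meaningless case of two infinite terms. *)
Definition integral_defined p (f : T -> \bar R) : Prop :=
  (\int[p]_t f^\+ t +? - \int[p]_t f^\- t)%E.

(* The library's [variance] has exactly the extended-real convention needed
   for the losses: it is +oo as soon as f is not square-integrable. *)
Lemma variance_not_square_integrable p (f : T -> R) :
  measurable_fun setT f -> f \notin Lfun p 2%:E -> variance p f = +oo%E.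
Proof.
move=> mf; apply: contraNeq => vfoo.
have {vfoo} : (variance p f < +oo)%E by rewrite ltey.
rewrite /variance !unlock; set c := fine _ => vf.
have mg : measurable_fun setT (f \- cst c) by apply: measurable_realfun.measurable_funB.
have L2g : f \- cst c \in Lfun p 2%:E.
  rewrite inE; apply/andP; split; rewrite inE//= /finite_norm unlock.
  rewrite poweR_lty//; apply: le_lt_trans vf.
  by under eq_integral => x _ do rewrite /= powR_mulrn// real_normK ?num_real//.
have -> : f = (f \- cst c) \+ cst c by apply/funext => x /=; rewrite subrK.
by rewrite rpredD ?lee1n//= => ?; exact: Lfun_cst.
Qed.

End distributions.

Section policies.
Context dX dY (X : measurableType dX) (Y : measurableType dY) (R : realType).

Definition policy := X -> probability Y R.

Variables (rho : probability X R) (r : X -> Y -> R) (beta : R) (piref : policy).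
Implicit Types (pi mu : policy) (C : set policy) (L : policy -> \bar R).

Definition objective_at pi x : \bar R :=
  ('E_(pi x)[r x] - beta%:E * KL (pi x) (piref x))%E.

Definition objective pi : \bar R := (\int[rho]_x objective_at pi x)%E.

(* KL itself needs no condition: the negative part of ln (p / q) is always
   p-integrable when p `<< q. *)
Definition objective_well_defined pi : Prop :=
  [/\ forall x, prob_support rho x ->
        integral_defined (pi x) (fun y => (r x y)%:E) /\
        ('E_(pi x)[r x] +? - (beta%:E * KL (pi x) (piref x)))%E,
      integral_defined rho (objective_at pi)
    & (objective pi < +oo)%E].

Definition optimal_policy pi : Prop :=
  objective_well_defined pi /\
  forall pi', objective_well_defined pi' -> (objective pi' <= objective pi)%E.

Definition same_support_policies : set policy :=
  [set pi | forall x, prob_support rho x ->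
              prob_support (pi x) = prob_support (piref x)].

Definition reg_reward pi x y : R :=
  r x y - beta * ln (prob_at (pi x) y / prob_at (piref x) y).

Definition on_policy_loss pi : \bar R :=
  ((2^-1)%:E * \int[rho]_x 'V_(pi x)[reg_reward pi x])%E.

Definition off_policy_loss mu pi : \bar R :=
  ((2^-1)%:E * \int[rho]_x 'V_(mu x)[reg_reward pi x])%E.

Definition global_min C L pi : Prop :=
  C pi /\ forall pi', C pi' -> (L pi <= L pi')%E.

(* Uniqueness is up to the values on prompts outside the support of rho. *)
Definition unique_global_min C L pi : Prop :=
  global_min C L pi /\
  forall pi', global_min C L pi' ->
    forall x, prob_support rho x -> pi' x =1 pi x.

End policies.

(* Main.v *)
Require Import Defs.
From mathcomp Require Import all_boot all_order all_algebra.
From mathcomp Require Import all_classical all_reals all_analysis.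
From mathcomp Require Import ring lra.

(* Changing an optimal policy at a single prompt x of positive mass shows that
   p = pi*(.|x) maximizes the regularized value at x.  Redistributing the mass
   of p on two responses a, b affects only two terms of that value, so p is
   optimal for the finite problem on {a, b}; Gibbs' inequality solves the
   latter and gives p(a) / p(b) = w(a) / w(b) with w = pi_ref e^(r / beta).
   Hence p is proportional to w, with no need for the partition function
   sum_y w(y) to be known to be finite.  On the other hand, among policies with
   the support of pi_ref, a vanishing variance of the regularized reward (under
   any such policy) means that this reward is constant on the support, i.e.
   that the policy is proportional to w.  So pi* has zero loss, which is
   minimal, and zero loss characterizes it. *)

Set Implicit Arguments.
Unset Strict Implicit.
Unset Printing Implicit Defensive.

Import Order.TTheory GRing.Theory Num.Theory.

Local Open Scope classical_set_scope.
Local Open Scope ring_scope.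

(** * Atoms and supports on a countable discrete space *)

Section discrete_measures.
Context d (T : measurableType d) (R : realType) (hT : countable_discrete T).
Implicit Types (m : {measure set T -> \bar R}) (p q : probability T R).

Lemma measurable_discrete (A : set T) : measurable A.
Proof. exact: hT.2. Qed.
#[local] Hint Resolve measurable_discrete : core.

Lemma measurable_fun_discrete d' (U : measurableType d') (D : set T)
  (f : T -> U) : measurable_fun D f.
Proof. by move=> _ B _; exact: measurable_discrete. Qed.
#[local] Hint Resolve measurable_fun_discrete : core.

(** An injection of the space into the naturals cuts [A] into countably many disjoint fibres, each
    empty or a singleton, and countable additivity sums them. *)
Lemma measure_eq_atoms m1 m2 :
  (forall t, m1 [set t] = m2 [set t]) -> forall A, m1 A = m2 A.
Proof.
move=> m12 A; have /countable_injP[f finj] := hT.1.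
pose F n := A `&` f @^-1` [set n].
have -> : A = \bigcup_n F n.
  by apply/seteqP; split=> [t At|t [n _ []]//]; exists (f t).
have tF : trivIset setT F by move=> i j _ _ [t [[_ <-] [_ <-]]].
rewrite !measure_bigcup//; apply: eq_eseriesr => n _.
have [[t Ft]|F0] := pselect (F n !=set0); last first.
  have -> : F n = set0 by apply/seteqP; split=> // t Ft; case: F0; exists t.
  by rewrite !measure0.
suff -> : F n = [set t] by [].
apply/seteqP; split=> [s [_ fs]|_ ->//].
by apply: finj; rewrite ?inE//; case: Ft => _ ->.
Qed.

Lemma prob_atE p t : p [set t] = (prob_at p t)%:E.
Proof. by rewrite fineK// fin_num_measure. Qed.

Lemma prob_at_ge0 p t : 0 <= prob_at p t.
Proof. exact: fine_ge0. Qed.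

Lemma prob_at_out p t : ~ prob_support p t -> prob_at p t = 0.
Proof.
by move=> /negP; rewrite -leNgt => p0; apply/eqP; rewrite eq_le p0 prob_at_ge0.
Qed.

Lemma prob_notin_support p : p (~` prob_support p) = 0%E.
Proof.
(* Compare the restriction of [p] with the zero measure: by [measure_eq_atoms] only atoms matter,
   and there both vanish. *)
transitivity (mrestr p (measurable_discrete (~` prob_support p)) setT).
  by rewrite /mrestr setTI.
transitivity ((mzero : {measure set T -> \bar R}) setT) => //.
apply: (@measure_eq_atoms (mrestr p _)) => t.
change (p ([set t] `&` ~` prob_support p) = 0%E).
apply/eqP; rewrite eq_le measure_ge0 andbT.
have [st|/prob_at_out nst] := pselect (prob_support p t).
  suff -> : [set t] `&` ~` prob_support p = set0 by rewrite measure0.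
  by apply/seteqP; split=> // s [/= ->].
have <- : p [set t] = 0%E by rewrite prob_atE nst.
by rewrite le_measure ?inE.
Qed.

Lemma prob_support_nonempty p : prob_support p !=set0.
Proof.
apply: contrapT => /nonemptyPn p0; have := prob_notin_support p.
by rewrite p0 setC0 probability_setT => /eqP; rewrite onee_eq0.
Qed.

Lemma ae_prob_support p (P : T -> Prop) :
  {ae p, forall t, P t} <-> (forall t, prob_support p t -> P t).
Proof.
split=> [[N [_ N0 PN]] t pt|PP].
  apply: contrapT => nPt; move: pt; rewrite /prob_support/= /prob_at.
  suff -> : p [set t] = 0%E by rewrite ltxx.
  apply/eqP; rewrite eq_le measure_ge0 andbT -N0 le_measure ?inE//.
  by move=> _ ->; exact: PN.
exists (~` prob_support p); split=> // [|t nPt pt].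
  exact: prob_notin_support.
by apply: nPt; exact: PP.
Qed.

Lemma dominates_support p q :
  p `<< q <-> prob_support p `<=` prob_support q.
Proof.
split=> [/null_content_dominatesP pq t|pq].
  apply: contraPP => /prob_at_out qt0; rewrite /prob_support/= /prob_at.
  have q0 : q [set t] = 0%E by rewrite prob_atE qt0.
  have -> : p [set t] = 0%E by exact: pq.
  by rewrite ltxx.
apply/null_content_dominatesP => A _ qA.
have : {ae q, forall t, ~ A t}.
  by exists A; split=> // t /contrapT.
move/ae_prob_support => qnA.
have : {ae p, forall t, ~ A t}.
  by apply/ae_prob_support => t /pq; exact: qnA.
move=> [N [_ N0 AN]]; apply/eqP; rewrite eq_le measure_ge0 andbT -N0.
by rewrite le_measure ?inE// => t At; exact: AN.
Qed.

(** A point of positive mass gives [0 <= c], so [c q] is a measure with the atoms of [p]; equal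
    total masses then force [c = 1]. *)
Lemma prob_eq_proportional p q (c : R) :
  (forall t, prob_at p t = c * prob_at q t) -> p =1 q.
Proof.
move=> pcq.
have [t pt] := prob_support_nonempty p.
have c0 : 0 <= c.
  move: (pt); rewrite /prob_support/= pcq; apply: contraTT.
  by rewrite -!ltNge -leNgt => c0; rewrite nmulr_rle0 ?prob_at_ge0.
have pE : p =1 mscale (NngNum c0) q.
  apply: measure_eq_atoms => s.
  change (p [set s] = (c%:E * q [set s])%E).
  by rewrite !prob_atE pcq EFinM.
have c1 : c = 1.
  by have := pE setT; rewrite /mscale/= !probability_setT mule1 => -[].
by move=> A; rewrite pE /mscale/= c1 mul1e.
Qed.

(** * Integrals and variances on a discrete space *)

Lemma integral_atom m (f : T -> \bar R) t :
  (\int[m]_(s in [set t]) f s = f t * m [set t])%E.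
Proof.
by rewrite -integral_cst//; apply: eq_integral => s; rewrite inE => ->.
Qed.

Lemma integral_split1 p (f : T -> \bar R) t :
  (\int[p]_u f u = \int[p]_(u in ~` [set t]) f u + f t * (prob_at p t)%:E)%E.
Proof.
rewrite -prob_atE -(setUv [set t]) integral_setU//; last first.
  by apply/disj_setPS => u [].
by rewrite addeC integral_atom.
Qed.

Lemma integrable_update p (f g : T -> \bar R) t :
  g t \is a fin_num -> (forall u, u <> t -> g u = f u) ->
  p.-integrable setT f -> p.-integrable setT g.
Proof.
move=> gt gf fi; apply/integrableP; split=> //.
rewrite (integral_split1 p _ t) lte_add_pinfty//; last first.
  by rewrite ltey_eq fin_numM// abse_fin_num.
rewrite (@eq_integral _ _ _ _ _ (abse \o f)) => [|u]; last first.
  by rewrite inE => /= ut; rewrite gf.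
have /integrableP[//] : p.-integrable (~` [set t]) f.
exact: integrableS fi.
Qed.

Lemma integrable_integral_defined p (f : T -> \bar R) :
  p.-integrable setT f -> integral_defined p f.
Proof.
by move=> fi; apply: fin_num_adde_defr; exact: integrable_pos_fin_num.
Qed.

Lemma integral_split2 p (f : T -> \bar R) s t : s <> t ->
  (\int[p]_u f u = \int[p]_(u in ~` [set s; t]) f u
     + (f s * (prob_at p s)%:E + f t * (prob_at p t)%:E))%E.
Proof.
move=> st; rewrite -!prob_atE -(setUv [set s; t]) integral_setU//; last first.
  by apply/disj_setPS => u [].
rewrite addeC integral_setU// ?integral_atom//.
by apply/disj_setPS => u [->].
Qed.

(** The integral is a difference of two nonnegative parts, and it is infinite as soon as one of them
    is. *)
Lemma integrable_of_fin_num m (f : T -> \bar R) :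
  (\int[m]_t f t)%E \is a fin_num -> m.-integrable setT f.
Proof.
move=> f_fin; apply/integrableP; split=> //.
by apply/abse_integralP=> //; rewrite -fin_num_abs.
Qed.

Lemma eq_integral_support p (f g : T -> \bar R) :
  (forall t, prob_support p t -> f t = g t) ->
  (\int[p]_t f t = \int[p]_t g t)%E.
Proof.
move=> fg; apply: ae_eq_integral => //.
by apply/ae_prob_support => t /fg.
Qed.

Lemma integral_eq0_support p (f : T -> \bar R) : (forall t, (0 <= f t)%E) ->
  (\int[p]_t f t = 0)%E <-> forall t, prob_support p t -> f t = 0%E.
Proof.
move=> f0; have -> : (\int[p]_t f t = \int[p]_t `|f t|)%E.
  by apply: eq_integral => t _; rewrite gee0_abs.
split=> [/ae_eq_integral_abs fE|fE].
  have /ae_prob_support fE' : ae_eq p setT f (cst 0%E) by exact: fE.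
  by move=> t /fE' /(_ I).
apply/ae_eq_integral_abs => //; apply/ae_prob_support => t /fE + _; exact.
Qed.

(** A null integral of a square vanishes on the support, so [f] equals the centering constant [c]
    there, even if [c] were only the default value of [fine]. Conversely a constant on the support
    is its own mean. *)
Lemma variance_eq0 p (f : T -> R) :
  'V_p[f] = 0%E <-> exists c, forall t, prob_support p t -> f t = c.
Proof.
rewrite /variance !unlock; set c := fine _.
have sq0 t : (0 <= (((f \- cst c) * (f \- cst c)) t)%:E)%E.
  by rewrite lee_fin; exact: sqr_ge0.
split=> [/(integral_eq0_support _ sq0) V0|[k fk]].
  exists c => t /V0[] /eqP.
  by rewrite mulf_eq0 orbb subr_eq0 => /eqP.
have ck : c = k.
  rewrite /c (@eq_integral_support p _ (cst k%:E)) => [|t /fk ->//].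
  by rewrite integral_cst// [X in (_ * X)%E]probability_setT mule1.
apply/integral_eq0_support => // t pt.
by rewrite !fctE/= fk// ck subrr mulr0.
Qed.

(** * Redistribution of mass on two points, and Gibbs' inequality *)

Lemma integrable_update2 p p' (a b : T) (f f' : T -> R) : a <> b ->
  (forall A, A `<=` ~` [set a; b] -> p' A = p A) ->
  (forall t, t <> a -> t <> b -> f' t = f t) ->
  p.-integrable setT (EFin \o f) -> p'.-integrable setT (EFin \o f').
Proof.
move=> ab p'p f'f fi; apply/integrableP; split=> //.
rewrite (integral_split2 p' _ ab)/=.
rewrite (@eq_measure_integral _ _ _ _ p) => [|A _ /p'p//].
rewrite lte_add_pinfty ?ltry//.
rewrite (@eq_integral _ _ _ _ _ (abse \o (EFin \o f))) => [|t]; last first.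
  by rewrite inE => /not_orP[ta tb] /=; rewrite f'f.
have /integrableP[//] : p.-integrable (~` [set a; b]) (EFin \o f).
exact: integrableS fi.
Qed.

(** Restrict [p] to the complement of the two points and add two Dirac masses; the condition on
    [s + t] preserves the total mass. *)
Lemma two_point_modification p (a b : T) (s t : R) :
  a <> b -> 0 <= s -> 0 <= t -> s + t = prob_at p a + prob_at p b ->
  exists p', [/\ prob_at p' a = s, prob_at p' b = t
    & forall A, A `<=` ~` [set a; b] -> p' A = p A].
Proof.
move=> ab s0 t0 st; pose D := ~` [set a; b].
pose m : {measure set T -> \bar R} :=
  measure_add (mrestr p (measurable_discrete D))
   (measure_add (mscale (NngNum s0) \d_a) (mscale (NngNum t0) \d_b)).
have mE A : m A = (p (A `&` D) + (s%:E * \d_a A + t%:E * \d_b A))%E.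
  rewrite [LHS]measure_addE; congr (_ + _)%E.
  exact: measure_addE.
have m1 : m setT = 1%E.
  rewrite mE setTI !diracT !mule1 -EFinD st EFinD -!prob_atE.
  have <- : p [set a; b] = (p [set a] + p [set b])%E.
    by rewrite measureU//; apply/seteqP; split=> // u [/= ->].
  have <- : p ([set a; b] `|` D) = 1%E by rewrite setUv probability_setT.
  by rewrite addeC; apply/esym/measureU => //; exact: setICr.
(* As m has mass 1, [mnormalize] only packages it as a probability. *)
pose p' : probability T R := mnormalize m p.
have p'E A : p' A = (p (A `&` D) + (s%:E * \d_a A + t%:E * \d_b A))%E.
  by rewrite -mE /p' /= /mnormalize m1 onee_eq0/= invr1 mule1.
have aD : [set a] `&` D = set0.
  by apply/seteqP; split=> // u [/= ->] []; left.
have bD : [set b] `&` D = set0.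
  by apply/seteqP; split=> // u [/= ->] []; right.
exists p'; split=> [||A AD].
- rewrite /prob_at p'E aD measure0 !diracE mem_set// memNset/=; last first.
    by move=> /esym.
  by rewrite mulr1 mulr0 addr0 add0r.
- rewrite /prob_at p'E bD measure0 !diracE memNset// mem_set//=.
  by rewrite mulr1 mulr0 !add0r.
- rewrite p'E setIidl// !diracE !memNset/=.
  + by rewrite !mule0 !adde0.
  + by move=> /AD; apply; right.
  + by move=> /AD; apply; left.
Qed.

(** For [t > 0] this is [1 + u <= e^u] at [u = ln (s / t)], multiplied by [t]; it is strict unless
    [u = 0]. *)
Lemma gibbs_inequality (s t : R) : 0 < s -> 0 <= t ->
  t - s <= t * ln (t / s) ?= iff (t == s).
Proof.
move=> s0; rewrite le_eqVlt => /predU1P[<-|t0].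
  rewrite mul0r sub0r (lt_eqF s0); apply/leifP.
  by rewrite oppr_lt0.
have st0 : 0 < s / t by rewrite divr_gt0.
have -> : t * ln (t / s) = - (t * ln (s / t)).
  by rewrite -[t / s]invf_div lnV ?posrE// mulrN.
have sE : s = t * expR (ln (s / t)) by rewrite lnK ?posrE// mulrC divfK ?gt_eqF.
have [->|ts] := eqVneq t s.
  by apply/leifP/eqP; rewrite divff ?gt_eqF// ln1 subrr mulr0 oppr0.
apply/leifP; rewrite ltrNr opprB.
rewrite ltrBrDr [ltRHS]sE [ltLHS](_ : _ = t * (1 + ln (s / t))); last by ring.
rewrite ltr_pM2l//; apply: expR_gt1Dx; apply: contra_neq ts => l0.
by rewrite [RHS]sE l0 expR0 mulr1.
Qed.

(** * Gibbs distributions *)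

Definition regularized (beta : R) (r : T -> R) q p : T -> R :=
  fun t => r t - beta * ln (prob_at p t / prob_at q t).

(** The constant [c] stands for the inverse of the partition function. *)
Definition gibbs (beta : R) (r : T -> R) q p : Prop :=
  exists2 c, 0 < c &
    forall t, prob_at p t = c * (prob_at q t * expR (r t / beta)).

Lemma gibbs_unique beta r q p p' :
  gibbs beta r q p -> gibbs beta r q p' -> p =1 p'.
Proof.
move=> [c c0 pE] [c' c'0 p'E]; apply: (@prob_eq_proportional _ _ (c / c')) => t.
by rewrite p'E pE [RHS]mulrA divfK ?gt_eqF.
Qed.

Lemma gibbs_support beta r q p :
  gibbs beta r q p -> prob_support p = prob_support q.
Proof.
move=> [c c0 pE]; apply/seteqP; split=> t; rewrite /prob_support/= pE;
  by rewrite pmulr_rgt0// pmulr_lgt0// expR_gt0.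
Qed.

(** Taking logarithms in [p = c q e^(r / beta)] turns proportionality into constancy, with
    [k = - beta ln c]; off the common support both sides of the Gibbs equation are 0. *)
Lemma gibbs_regularized beta r q p : 0 < beta ->
  prob_support p = prob_support q ->
  gibbs beta r q p <->
  exists k, forall t, prob_support q t -> regularized beta r q p t = k.
Proof.
move=> b0 pq; have bn0 : beta != 0 by rewrite gt_eqF.
split=> [[c c0 pE]|[k regk]].
  exists (- (beta * ln c)) => t qt; rewrite /regularized pE.
  have -> : c * (prob_at q t * expR (r t / beta)) / prob_at q t
    = c * expR (r t / beta) by field; rewrite gt_eqF.
  rewrite lnM ?posrE ?expR_gt0// expRK; field.
  by rewrite bn0.
exists (expR (- (k / beta))) => [|t]; first exact: expR_gt0.
have [qt|nqt] := pselect (prob_support q t); last first.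
  by rewrite !prob_at_out ?mul0r ?mulr0 ?pq.
have pt : prob_support p t by rewrite pq.
have := regk _ qt; rewrite /regularized => rk.
have lE : ln (prob_at p t / prob_at q t) = - (k / beta) + r t / beta.
  by rewrite -rk; field.
by rewrite mulrCA -expRD -lE lnK ?posrE ?divr_gt0// mulrC divfK// gt_eqF.
Qed.

(** * Optimality at a single prompt *)

Definition prompt_value (beta : R) (r : T -> R) q p : \bar R :=
  ('E_p[r] - beta%:E * KL p q)%E.

Definition log_ratio q p t : R := ln (prob_at p t / prob_at q t).

(** Under these conditions reward and divergence merge into one finite integral, in which the
    contribution of two points can be isolated. *)
Definition integrable_terms (r : T -> R) q p : Prop :=
  [/\ p `<< q, p.-integrable setT (EFin \o r)
    & p.-integrable setT (EFin \o log_ratio q p)].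

(** A difference is finite only if both terms are, and scaling by [beta > 0] keeps an infinite
    divergence infinite. *)
Lemma integrable_terms_of_fin_value beta r q p : 0 < beta ->
  prompt_value beta r q p \is a fin_num -> integrable_terms r q p.
Proof.
move=> b0; rewrite /prompt_value fin_numB => /andP[Er].
rewrite /KL; case: asboolP => [pq|_]; last by rewrite gt0_muley.
move=> KLfin; split=> //; apply: integrable_of_fin_num.
  by rewrite unlock in Er.
move: KLfin; rewrite unlock -/(log_ratio q p).
by case: (\int[p]_t _)%E => [//| |]; rewrite ?gt0_muley ?gt0_muleNy ?lte_fin.
Qed.

Lemma prompt_valueE beta r q p : integrable_terms r q p ->
  prompt_value beta r q p = (\int[p]_t (regularized beta r q p t)%:E)%E.
Proof.
move=> [pq ri li]; rewrite /prompt_value /KL asboolT// !unlock.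
rewrite -integralZl// -integralB//.
exact: integrableZl.
Qed.

Lemma integrable_regularized beta r q p : integrable_terms r q p ->
  p.-integrable setT (EFin \o regularized beta r q p).
Proof.
move=> [pq ri li].
have := integrableB measurableT ri (integrableZl measurableT beta li).
exact.
Qed.

(* With w = q e^(r / beta) this term is -beta t ln(t / w); comparing t with the
   candidate value k w isolates the Gibbs term t ln(t / (k w)). *)
Lemma regularized_term beta (r q t k : R) : 0 < beta -> 0 < q -> 0 < k ->
  0 <= t ->
  t * (r - beta * ln (t / q)) =
  - (beta * ln k * t) - beta * (t * ln (t / (k * (q * expR (r / beta))))).
Proof.
move=> b0 q0 k0; rewrite le_eqVlt => /predU1P[<-|t0].
  by rewrite !mul0r !mulr0 subr0 oppr0.
have bn0 : beta != 0 by rewrite gt_eqF.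
have -> : ln (t / q) = ln (t / (k * (q * expR (r / beta)))) + ln k + r / beta.
  have w0 : 0 < k * (q * expR (r / beta)) by rewrite !mulr_gt0 ?expR_gt0.
  rewrite -[X in _ = _ + X]expRK -!lnM ?posrE ?mulr_gt0 ?invr_gt0 ?expR_gt0//.
  congr ln; field.
  by rewrite !gt_eqF ?expR_gt0.
by field.
Qed.

(** The competitor [p'] has masses [k wa] and [k wb] at the two points. Optimality of [p] bounds the
    sum of its two Gibbs terms above by 0, Gibbs' inequality bounds it below by 0, and the equality
    case identifies [p] with [p'] there. The mass of [p] at [b] may a priori be 0. *)
Lemma two_point_optimality beta r q p a b : 0 < beta ->
  integrable_terms r q p -> a <> b ->
  prob_support p a -> prob_support q b ->
  (forall p', integrable_terms r q p' ->
     (prompt_value beta r q p' <= prompt_value beta r q p)%E) ->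
  prob_at p a * (prob_at q b * expR (r b / beta)) =
  prob_at p b * (prob_at q a * expR (r a / beta)).
Proof.
move=> b0 pt ab pa qb popt; have [pq ri li] := pt.
have qa : prob_support q a by exact: (dominates_support p q).1 pa.
set wa := prob_at q a * _; set wb := prob_at q b * _.
have wa0 : 0 < wa by rewrite mulr_gt0// expR_gt0.
have wb0 : 0 < wb by rewrite mulr_gt0// expR_gt0.
(* This [k] gives the weights on [a], [b] the total mass that [p] has there. *)
set k := (prob_at p a + prob_at p b) / (wa + wb).
have k0 : 0 < k by rewrite divr_gt0 ?(addr_gt0 wa0)// ltr_wpDr ?prob_at_ge0.
have sa0 : 0 < k * wa by rewrite mulr_gt0.
have sb0 : 0 < k * wb by rewrite mulr_gt0.
have sum_k : k * wa + k * wb = prob_at p a + prob_at p b.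
  by rewrite -mulrDr divfK// gt_eqF// addr_gt0.
have [p' [p'a p'b p'p]] := two_point_modification ab (ltW sa0) (ltW sb0) sum_k.
have p'pt t : t <> a -> t <> b -> prob_at p' t = prob_at p t.
  by move=> ta tb; rewrite /prob_at p'p// => u -> [].
have p't : integrable_terms r q p'.
  split.
  - apply/dominates_support => t p't.
    have [->//|ta] := pselect (t = a).
    have [->//|tb] := pselect (t = b).
    apply: ((dominates_support p q).1 pq).
    by rewrite /prob_support/= -p'pt.
  - exact: (integrable_update2 ab p'p _ ri).
  - apply: (integrable_update2 ab p'p _ li) => t ta tb.
    by rewrite /log_ratio p'pt.
have := popt _ p't; rewrite !prompt_valueE//.
rewrite !(integral_split2 _ _ ab) p'a p'b.
rewrite (@eq_measure_integral _ _ _ _ p) => [|A _ /p'p//].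
rewrite (@eq_integral _ _ _ _ _ (EFin \o regularized beta r q p)); last first.
  by move=> t; rewrite inE => /not_orP[ta tb]; rewrite /regularized/= p'pt.
(* The common integral off the two points is finite, so it cancels. *)
rewrite leeD2lE; last first.
  apply: integrable_fin_num => //.
  exact: integrableS (integrable_regularized beta pt).
rewrite -!EFinM -!EFinD lee_fin ![_ * prob_at _ _]mulrC ![_ * (k * _)]mulrC.
rewrite /regularized p'a p'b.
rewrite !(@regularized_term beta _ _ _ k) ?prob_at_ge0 ?(ltW sa0) ?(ltW sb0)//.
rewrite -/wa -/wb.
(* For [p'] the ratios to [k wa] and [k wb] are 1, so its Gibbs terms disappear. *)
rewrite !divff ?gt_eqF// ln1 !mulr0 !subr0 => le_terms.
have := gibbs_inequality sa0 (prob_at_ge0 p a).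
have := gibbs_inequality sb0 (prob_at_ge0 p b).
set Xa := _ * ln _ in le_terms *; set Xb := prob_at p b * ln _ in le_terms *.
move=> [lb eb] [la ea].
(* The linear terms in [beta ln k] cancel because [p] and [p'] have the same mass on the pair. *)
have X0 : Xa + Xb <= 0.
  rewrite -(pmulr_rle0 _ b0) mulrDr; move: le_terms sum_k.
  set u := beta * ln k => le_terms sum_k.
  have : u * (k * wa + k * wb) = u * (prob_at p a + prob_at p b).
    by rewrite sum_k.
  by rewrite !mulrDr; lra.
have /eqP : prob_at p a == k * wa by rewrite -ea; apply/eqP; lra.
have /eqP : prob_at p b == k * wb by rewrite -eb; apply/eqP; lra.
by move=> -> ->; rewrite mulrAC.
Qed.

(** One point [a] of positive mass serves as reference: comparing every [b] in the support of [q]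
    with it yields the same ratio of [p] to the weight. Elsewhere absolute continuity makes both
    vanish. *)
Lemma gibbs_of_optimal beta r q p : 0 < beta ->
  integrable_terms r q p ->
  (forall p', integrable_terms r q p' ->
     (prompt_value beta r q p' <= prompt_value beta r q p)%E) ->
  gibbs beta r q p.
Proof.
move=> b0 pt popt; have [a pa] := prob_support_nonempty p.
have [/dominates_support pq _ _] := pt.
have wa0 : 0 < prob_at q a * expR (r a / beta).
  by rewrite mulr_gt0 ?expR_gt0//; exact: pq.
exists (prob_at p a / (prob_at q a * expR (r a / beta))) => [|b].
  by rewrite divr_gt0.
have [qb|nqb] := pselect (prob_support q b); last first.
  have npb : ~ prob_support p b by move=> /pq.
  by rewrite (prob_at_out npb) (prob_at_out nqb) mul0r mulr0.
have [<-|ab] := pselect (a = b); first by rewrite divfK ?gt_eqF.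
rewrite mulrAC; apply: (canRL (mulfK _)); rewrite ?gt_eqF//.
by rewrite (two_point_optimality b0 pt ab pa qb popt).
Qed.

End discrete_measures.

(** * From single prompts to policies and losses *)

Section policies.
Context dX dY (X : measurableType dX) (Y : measurableType dY) (R : realType).
Context (hX : countable_discrete X) (hY : countable_discrete Y).
Context (rho : probability X R) (r : X -> Y -> R) (piref : policy X Y R).
Context (beta : R) (beta_gt0 : 0 < beta).
Implicit Types pi mu : policy X Y R.

Let pi_gibbs pi x := gibbs beta (r x) (piref x) (pi x).

(** Substituting [p] for [pistar] at [x] alone gives an admissible competitor. The finite
    contribution of the other prompts cancels, and so does the positive mass of [x]. *)
Lemma prompt_optimality pistar x p :
  optimal_policy rho r beta piref pistar ->
  objective rho r beta piref pistar \is a fin_num ->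
  prob_support rho x -> integrable_terms (r x) (piref x) p ->
  (prompt_value beta (r x) (piref x) p <=
   prompt_value beta (r x) (piref x) (pistar x))%E.
Proof.
move=> [[wd def _] opt] fin rx pt.
pose pi' : policy X Y R := fun z => if pselect (z = x) then p else pistar z.
have pi'x : pi' x = p by rewrite /pi'; case: pselect.
have pi'z z : z <> x -> pi' z = pistar z by rewrite /pi'; case: pselect.
have p_fin : objective_at r beta piref pi' x \is a fin_num.
  rewrite /objective_at pi'x -/(prompt_value _ _ _ _) prompt_valueE//.
  by apply: integrable_fin_num => //; exact: integrable_regularized.
have off z : z <> x ->
    objective_at r beta piref pi' z = objective_at r beta piref pistar z.
  by move=> zx; rewrite /objective_at pi'z.
have star_int := integrable_of_fin_num hX fin.
have pi'_int := integrable_update hX p_fin off star_int.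
have wd' : objective_well_defined rho r beta piref pi'.
  split=> [z rz||].
  - have [->|zx] := pselect (z = x); last by rewrite pi'z//; exact: wd.
    have [_ ri _] := pt; rewrite pi'x; split.
      exact: integrable_integral_defined.
    by apply: fin_num_adde_defr; rewrite unlock; exact: integrable_fin_num.
  - exact: integrable_integral_defined.
  - exact: integrable_lty.
have := opt _ wd'; rewrite /objective !(integral_split1 hX _ _ x).
rewrite (@eq_integral _ _ _ _ _ (objective_at r beta piref pistar)); last first.
  by move=> z; rewrite inE => /= /off.
rewrite leeD2lE; last first.
  have mx : measurable (~` [set x]) by exact: (measurable_discrete hX).
  by apply: integrable_fin_num => //; exact: integrableS star_int.
by rewrite lee_pmul2r ?lte_fin// /objective_at pi'x.
Qed.

Lemma optimal_gibbs pistar x :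
  optimal_policy rho r beta piref pistar ->
  objective rho r beta piref pistar \is a fin_num ->
  prob_support rho x -> pi_gibbs pistar x.
Proof.
move=> opt fin rx; apply: gibbs_of_optimal => // [|p pt].
  apply: integrable_terms_of_fin_value beta_gt0 _ => //.
  (* An integrable function is finite almost everywhere, hence at every prompt of positive mass. *)
  have := integrable_ae measurableT (integrable_of_fin_num hX fin).
  move/(ae_prob_support hX) => /(_ x rx I); exact.
exact: prompt_optimality.
Qed.

Lemma off_policy_loss_ge0 mu pi :
  (0 <= off_policy_loss rho r beta piref mu pi)%E.
Proof.
apply: mule_ge0; first by rewrite lee_fin invr_ge0.
by apply: integral_ge0 => x _; exact: variance_ge0.
Qed.

(** A null integral of variances makes each one vanish on the support of [rho]; the reward is then
    constant on the support of [mu], which is that of [piref], so [gibbs_regularized] applies. *)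
Lemma off_policy_loss_eq0 mu pi :
  same_support_policies rho piref mu -> same_support_policies rho piref pi ->
  off_policy_loss rho r beta piref mu pi = 0%E <->
  forall x, prob_support rho x -> pi_gibbs pi x.
Proof.
move=> suppmu supppi.
have -> : off_policy_loss rho r beta piref mu pi = 0%E <->
  (\int[rho]_x 'V_(mu x)[reg_reward r beta piref pi x])%E = 0%E.
  split=> [/eqP|L0]; last by rewrite /off_policy_loss L0 mule0.
  by rewrite mule_eq0 eqe invr_eq0 pnatr_eq0/= => /eqP.
rewrite integral_eq0_support//; last by move=> x; exact: variance_ge0.
have gibbsP x : prob_support rho x ->
    'V_(mu x)[reg_reward r beta piref pi x] = 0%E <-> pi_gibbs pi x.
  move=> rx; rewrite variance_eq0// suppmu//.
  by rewrite /pi_gibbs gibbs_regularized// supppi.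
by split=> H x rx; apply/gibbsP => //; exact: H.
Qed.

(** Stated for an abstract [L] to treat both losses at once: the minimum is 0 and at each prompt the
    Gibbs distribution is unique. *)
Lemma gibbs_unique_global_min (L : policy X Y R -> \bar R) pistar :
  (forall x, prob_support rho x -> pi_gibbs pistar x) ->
  (forall pi, 0 <= L pi)%E ->
  (forall pi, same_support_policies rho piref pi ->
    L pi = 0%E <-> forall x, prob_support rho x -> pi_gibbs pi x) ->
  unique_global_min rho (same_support_policies rho piref) L pistar.
Proof.
move=> star_gibbs L_ge0 L_eq0.
have star_supp : same_support_policies rho piref pistar.
  by move=> x /star_gibbs /gibbs_support.
have star0 : L pistar = 0%E by apply/L_eq0.
split=> [|pi [supp_pi min_pi] x rx].
  by split=> // pi _; rewrite star0.
have pi0 : L pi = 0%E.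
  by apply/eqP; rewrite eq_le L_ge0 andbT -star0; exact: min_pi.
by apply: gibbs_unique (star_gibbs _ rx) => //; apply: (L_eq0 _ supp_pi).1.
Qed.

End policies.

Unset Implicit Arguments.

Theorem theorem2 (R : realType) (dX dY : measure_display)
    (X : measurableType dX) (Y : measurableType dY)
    (hX : countable_discrete X) (hY : countable_discrete Y)
    (rho : probability X R) (r : X -> Y -> R)
    (piref mu : policy X Y R)
    (beta : R) (hbeta : 0 < beta)
    (hmu : same_support_policies rho piref mu)
    (pistar : policy X Y R)
    (hopt : optimal_policy rho r beta piref pistar)
    (hfin : objective rho r beta piref pistar \is a fin_num) :
  unique_global_min rho (same_support_policies rho piref)
    (on_policy_loss rho r beta piref) pistar /\
  unique_global_min rho (same_support_policies rho piref)
    (off_policy_loss rho r beta piref mu) pistar.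
Proof.
have star_gibbs x (rx : prob_support rho x) :=
  optimal_gibbs hX hY hbeta hopt hfin rx.
split; apply: (gibbs_unique_global_min hY star_gibbs) => pi.
(* The on-policy loss at [pi] is by definition the off-policy loss with behavior policy [pi], so the
   off-policy lemmas cover it. *)
- exact: off_policy_loss_ge0.
- by move=> supp_pi; exact: off_policy_loss_eq0.
- exact: off_policy_loss_ge0.
- by move=> supp_pi; exact: off_policy_loss_eq0.
Qed.
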